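(* Let $R_0\subseteq R$ be rings. The following are equivalent: (a) There is a ring $S\supseteq R$ and a set $\Sigma\subseteq \mathrm{End}(S)$ such that $R_0=R^{\Sigma}$. (b) There is a ring $S\supseteq R$ and a subset $X\subseteq S$ such that $R_0=\mathrm{Cent}_R(X)$. (c) There is a ring $S\supseteq R$ and $\sigma\in\mathrm{Aut}(S)$ such that $\sigma^2=\mathrm{id}$ and $R_0=R^{\{\sigma\}}$. (d) There is a ring $S\supseteq R$ and an inner automorphism $\sigma\in\mathrm{Aut}(S)$ such that $\sigma^2=\mathrm{id}$ and $R_0=R^{\{\sigma\}}$. (e) There are rings $\{S_i\}_{i\in I}$ and ring homomorphisms $\psi_i^{(1)},\psi_i^{(2)}:R\to S_i$ ($i\in I$) such that $R_0=\{r\in R : \psi_i^{(1)}(r)=\psi_i^{(2)}(r)\ \text{for all } i\in I\}$.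
   Context: All rings are unital (not necessarily commutative), ring homomorphisms preserve the unity, and subrings share the unity of the ambient ring. $\mathrm{End}(S)$ and $\mathrm{Aut}(S)$ denote the sets of ring endomorphisms and ring automorphisms of $S$. For a ring $S\supseteq R$ and $\Sigma\subseteq\mathrm{End}(S)$, $R^{\Sigma}:=\{r\in R : \sigma(r)=r\ \text{for all }\sigma\in\Sigma\}$ (elements of $\Sigma$ need not map $R$ into $R$, nor be injective or surjective). For $X\subseteq S$, $\mathrm{Cent}_R(X):=\{r\in R : rx=xr\ \text{for all } x\in X\}$. (Condition (a) says that $R_0$ is a semi-invariant subring of $R$, and (b) says that it is a semi-centralizer subring.) *)

(* Defs.v *)
From HB Require Import structures.
From mathcomp Require Import all_boot all_order all_algebra.
From mathcomp Require Import all_classical.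

Set Implicit Arguments.
Unset Strict Implicit.
Unset Printing Implicit Defensive.

Import GRing.Theory.
Local Open Scope classical_set_scope.
Local Open Scope ring_scope.

(* Rings are [pzRingType]s, so the zero ring is allowed. A ring containing R
   is a ring S with an injective ring homomorphism iota : R -> S, along which
   elements of R are viewed in S; End(S) is {rmorphism S -> S}. *)

Definition is_subring (R : pzRingType) (R0 : set R) : Prop :=
  GRing.subring_closed (mem R0).

Definition invariants (R S : pzRingType) (iota : {rmorphism R -> S})
    (Sigma : set {rmorphism S -> S}) : set R :=
  [set r | forall sigma, Sigma sigma -> sigma (iota r) = iota r].

Definition centralizer (R S : pzRingType) (iota : {rmorphism R -> S})
    (X : set S) : set R :=
  [set r | forall x, X x -> iota r * x = x * iota r].

Definition automorphism (S : pzRingType) (sigma : {rmorphism S -> S}) : Prop :=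
  bijective sigma.

(* A [pzRingType] carries no inversion, so the inverse v of u is explicit. *)
Definition inner_automorphism (S : pzRingType)
    (sigma : {rmorphism S -> S}) : Prop :=
  automorphism sigma /\
  exists u v : S, [/\ u * v = 1, v * u = 1 & forall x, sigma x = u * x * v].

(* Main.v *)
(** Condition (e) is the hub. An endomorphism sigma of S gives the pair
    iota, sigma o iota. An element x of S commutes with r exactly when
    conjugation by the unipotent matrix [[1, x], [0, 1]] fixes the scalar
    matrix r in M_2(S), so centralizers are equalizers too. Conversely, add the
    trivial pair (id_R, id_R) to the given family, to ensure injectivity, and
    let Psi1, Psi2 : R -> T be the maps into the product T of all the targets.
    Embed R in M_2(T) by r |-> diag(Psi1 r, Psi2 r): the swap matrix w is an
    involution exchanging the diagonal entries, so the equalizer is both the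
    centralizer of w and the invariant ring of conjugation by w. *)
Require Import Defs.
From HB Require Import structures.
From mathcomp Require Import all_boot all_order all_algebra.
From mathcomp Require Import all_classical.

Set Implicit Arguments.
Unset Strict Implicit.
Unset Printing Implicit Defensive.

Import GRing.Theory.
Local Open Scope classical_set_scope.
Local Open Scope ring_scope.

(** * Products of arbitrary families of rings *)

Definition product_ring (I : Type) (S : I -> pzRingType) : Type :=
  forall i, S i.

Section ProductRing.
Variables (I : Type) (S : I -> pzRingType).
Local Notation T := (product_ring S).

(** A ring structure includes decidable equality and choice; on functions over an arbitrary index
    type both come from classical axioms. *)
HB.instance Definition _ := gen_eqMixin T.
HB.instance Definition _ := gen_choiceMixin T.

Let add (f g : T) : T := fun i => f i + g i.
Let opp (f : T) : T := fun i => - f i.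
Let mul (f g : T) : T := fun i => f i * g i.
Let zero : T := fun=> 0.
Let one : T := fun=> 1.

Fact product_addA : associative add.
Proof. by move=> f g h; apply: functional_extensionality_dep => i; apply: addrA. Qed.
Fact product_addC : commutative add.
Proof. by move=> f g; apply: functional_extensionality_dep => i; apply: addrC. Qed.
Fact product_add0 : left_id zero add.
Proof. by move=> f; apply: functional_extensionality_dep => i; apply: add0r. Qed.
Fact product_addN : left_inverse zero opp add.
Proof. by move=> f; apply: functional_extensionality_dep => i; apply: addNr. Qed.

HB.instance Definition _ := GRing.isZmodule.Build T
  product_addA product_addC product_add0 product_addN.

Fact product_mulA : associative mul.
Proof. by move=> f g h; apply: functional_extensionality_dep => i; apply: mulrA. Qed.
Fact product_mul1l : left_id one mul.
Proof. by move=> f; apply: functional_extensionality_dep => i; apply: mul1r. Qed.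
Fact product_mul1r : right_id one mul.
Proof. by move=> f; apply: functional_extensionality_dep => i; apply: mulr1. Qed.
Fact product_mulDl : left_distributive mul add.
Proof. by move=> f g h; apply: functional_extensionality_dep => i; apply: mulrDl. Qed.
Fact product_mulDr : right_distributive mul add.
Proof. by move=> f g h; apply: functional_extensionality_dep => i; apply: mulrDr. Qed.

HB.instance Definition _ := GRing.Zmodule_isPzRing.Build T
  product_mulA product_mul1l product_mul1r product_mulDl product_mulDr.

End ProductRing.

Section ProductMap.
Variables (R : pzRingType) (I : Type) (S : I -> pzRingType).
Variable psi : forall i, {rmorphism R -> S i}.

Definition product_map (r : R) : product_ring S := fun i => psi i r.

Fact product_map_is_zmod_morphism : zmod_morphism product_map.
Proof. by move=> x y; apply: functional_extensionality_dep => i; apply: rmorphB. Qed.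

Fact product_map_is_monoid_morphism : monoid_morphism product_map.
Proof.
by split=> [|x y]; apply: functional_extensionality_dep => i;
  [apply: rmorph1 | apply: rmorphM].
Qed.

HB.instance Definition _ := GRing.isZmodMorphism.Build R (product_ring S)
  product_map product_map_is_zmod_morphism.
HB.instance Definition _ := GRing.isMonoidMorphism.Build R (product_ring S)
  product_map product_map_is_monoid_morphism.

End ProductMap.

(** * Inner automorphisms *)

Section Conjugation.
Variables (S : pzRingType) (u v : S).

(* The proofs are arguments of [conj_by] so that its morphism structure can be
   inferred from the term. *)
Definition conj_by (uv : u * v = 1) (vu : v * u = 1) (x : S) : S := u * x * v.

Variables (uv : u * v = 1) (vu : v * u = 1).

Fact conj_by_is_zmod_morphism : zmod_morphism (conj_by uv vu).
Proof. by move=> x y; rewrite /conj_by mulrBr mulrBl. Qed.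

Fact conj_by_is_monoid_morphism : monoid_morphism (conj_by uv vu).
Proof.
split=> [|x y]; first by rewrite /conj_by mulr1.
by rewrite /conj_by !mulrA -(mulrA (u * x) v u) vu mulr1.
Qed.

HB.instance Definition _ := GRing.isZmodMorphism.Build S S
  (conj_by uv vu) conj_by_is_zmod_morphism.
HB.instance Definition _ := GRing.isMonoidMorphism.Build S S
  (conj_by uv vu) conj_by_is_monoid_morphism.

(** Multiply on the right by [u] in one direction and by [v] in the other. This is the bridge
    between fixed points and centralizers. *)
Lemma conj_by_fixP x : conj_by uv vu x = x <-> x * u = u * x.
Proof.
rewrite /conj_by; split=> [{1}<-|<-]; first by rewrite -mulrA vu mulr1.
by rewrite -mulrA uv mulr1.
Qed.

End Conjugation.

(** Besides bijectivity, the case [u = v] shows that conjugation by an involution squares to the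
    identity. *)
Lemma conj_byK (S : pzRingType) (u v : S) (uv : u * v = 1) (vu : v * u = 1) :
  cancel (conj_by uv vu) (conj_by vu uv).
Proof.
by move=> x; rewrite /conj_by !mulrA vu mul1r -mulrA vu mulr1.
Qed.

Lemma inner_automorphism_conj_by (S : pzRingType) (u v : S)
    (uv : u * v = 1) (vu : v * u = 1) :
  inner_automorphism (conj_by uv vu : {rmorphism S -> S}).
Proof.
split; last by exists u, v.
by exists (conj_by vu uv); apply: conj_byK.
Qed.

(** * Two-by-two matrices over a ring *)

Section Matrices.
Variable S : pzRingType.

Definition transvection (x : S) : 'M[S]_(1 + 1) := block_mx 1%:M x%:M 0 1%:M.

Lemma transvectionN x : transvection x * transvection (- x) = 1.
Proof.
rewrite -[LHS]/(_ *m _) mulmx_block !mulmx0 !mul0mx !mul1mx !mulmx1.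
by rewrite !addr0 add0r -raddfD addNr raddf0 -scalar_mx_block.
Qed.

Lemma transvectionVN x : transvection (- x) * transvection x = 1.
Proof. by rewrite -{2}(opprK x) transvectionN. Qed.

(** Both products have [r] on the diagonal and 0 below it; their upper right entries are [r * x] and
    [x * r]. *)
Lemma scalar_transvection_commP r x :
  (r%:M : 'M[S]_(1 + 1)) * transvection x = transvection x * r%:M <->
  r * x = x * r.
Proof.
rewrite -[X in X = _]/(_ *m _) -[X in _ = X]/(_ *m _).
rewrite (scalar_mx_block 1 1 r) !mulmx_block.
rewrite !mulmx0 !mul0mx !mul1mx !mulmx1 !addr0 !add0r -!scalar_mxM.
split=> [/eq_block_mx[_ /matrixP/(_ 0 0)]|->//].
by rewrite !mxE eqxx !mulr1n.
Qed.

Definition swap : 'M[S]_(1 + 1) := block_mx 0 1%:M 1%:M 0.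

Lemma swapK : swap * swap = 1.
Proof.
rewrite -[LHS]/(_ *m _) mulmx_block !mulmx0 !mul0mx !mul1mx.
by rewrite !addr0 add0r -scalar_mx_block.
Qed.

Definition diag2 (a b : S) : 'M[S]_(1 + 1) := block_mx a%:M 0 0 b%:M.

Lemma diag2_inj a b a' b' : diag2 a b = diag2 a' b' -> a = a' /\ b = b'.
Proof.
move=> /eq_block_mx[/matrixP/(_ 0 0) + _ _ /matrixP/(_ 0 0)].
by rewrite !mxE eqxx !mulr1n.
Qed.

(** Both products are antidiagonal, with entries [a], [b] on one side and [b], [a] on the other. *)
Lemma diag2_swap_commP a b : diag2 a b * swap = swap * diag2 a b <-> a = b.
Proof.
rewrite -[X in X = _]/(_ *m _) -[X in _ = X]/(_ *m _) !mulmx_block.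
rewrite !mulmx0 !mul0mx !mul1mx !mulmx1 !addr0 !add0r.
split=> [/eq_block_mx[_ /matrixP/(_ 0 0)]|->//].
by rewrite !mxE eqxx !mulr1n.
Qed.

End Matrices.

Section DiagonalMap.
Variables (R S : pzRingType) (f g : {rmorphism R -> S}).

Definition diag_map (r : R) : 'M[S]_(1 + 1) := diag2 (f r) (g r).

Fact diag_map_is_zmod_morphism : zmod_morphism diag_map.
Proof.
move=> x y; rewrite /diag_map /diag2 opp_block_mx add_block_mx.
by rewrite oppr0 addr0 !rmorphB.
Qed.

Fact diag_map_is_monoid_morphism : monoid_morphism diag_map.
Proof.
split=> [|x y]; first by rewrite /diag_map /diag2 !rmorph1 -scalar_mx_block.
rewrite -[RHS]/(_ *m _) mulmx_block !mulmx0 !mul0mx !addr0 add0r.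
by rewrite /diag_map /diag2 !rmorphM.
Qed.

HB.instance Definition _ := GRing.isZmodMorphism.Build R 'M[S]_(1 + 1)
  diag_map diag_map_is_zmod_morphism.
HB.instance Definition _ := GRing.isMonoidMorphism.Build R 'M[S]_(1 + 1)
  diag_map diag_map_is_monoid_morphism.

End DiagonalMap.

(** * Equalizers and their realization as centralizers and invariants *)

Definition is_equalizer (R : pzRingType) (R0 : set R) : Prop :=
  exists (I : Type) (S : I -> pzRingType)
         (psi1 psi2 : forall i : I, {rmorphism R -> S i}),
    R0 = [set r | forall i : I, psi1 i r = psi2 i r].

Lemma invariants_is_equalizer (R S : pzRingType) (iota : {rmorphism R -> S})
    (Sigma : set {rmorphism S -> S}) :
  is_equalizer (invariants iota Sigma).
Proof.
pose I := {sigma : {rmorphism S -> S} | Sigma sigma}.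
exists I, (fun=> S).
exists (fun s : I => sval s \o iota : {rmorphism R -> S}), (fun=> iota).
apply/seteqP; split=> r /= inv_r; first by case=> sigma Ssigma; apply: inv_r.
by move=> sigma Ssigma; apply: (inv_r (exist _ sigma Ssigma)).
Qed.

Lemma centralizer_is_equalizer (R S : pzRingType) (iota : {rmorphism R -> S})
    (X : set S) :
  is_equalizer (centralizer iota X).
Proof.
pose cj x : {rmorphism 'M[S]_(1 + 1) -> 'M[S]_(1 + 1)} :=
  conj_by (transvectionN x) (transvectionVN x).
pose sc : {rmorphism R -> 'M[S]_(1 + 1)} := @scalar_mx S (1 + 1) \o iota.
exists {x | X x}, (fun=> 'M[S]_(1 + 1)).
exists (fun x : {x | X x} => cj (sval x) \o sc : {rmorphism R -> _}), (fun=> sc).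
apply/seteqP; split=> r /= cr.
  case=> x Xx /=; apply/conj_by_fixP/scalar_transvection_commP; exact: cr.
move=> x Xx; apply/scalar_transvection_commP.
by have /conj_by_fixP := cr (exist _ x Xx).
Qed.

Lemma equalizer_diagonal_swap (R : pzRingType) (R0 : set R) :
  is_equalizer R0 ->
  exists (T : pzRingType) (iota : {rmorphism R -> 'M[T]_(1 + 1)}),
    injective iota /\
    forall r, R0 r <-> iota r * swap T = swap T * iota r.
Proof.
move=> [I [S [psi1 [psi2 ->]]]].
(* The extra index [None] carries the trivial pair of identities on [R]: it adds no condition to the
   equalizer. *)
pose S' (o : option I) := if o is Some i then S i else R.
pose id_with (psi : forall i, {rmorphism R -> S i}) o : {rmorphism R -> S' o} :=
  if o is Some i then psi i else idfun : {rmorphism R -> R}.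
exists (product_ring S').
exists (diag_map (product_map (id_with psi1)) (product_map (id_with psi2))).
(* Injectivity is read off the [None] coordinate of the first diagonal entry, which is the element
   of [R] itself. *)
split=> [r s /diag2_inj[/(congr1 (fun f => f None))] //|r].
rewrite diag2_swap_commP; split=> [eq_r|/= eq_r i].
  by apply: functional_extensionality_dep => -[i|] //=; apply: eq_r.
by have := congr1 (fun f => f (Some i)) eq_r.
Qed.

Lemma equalizer_is_centralizer (R : pzRingType) (R0 : set R) :
  is_equalizer R0 ->
  exists (S : pzRingType) (iota : {rmorphism R -> S}) (X : set S),
    injective iota /\ R0 = centralizer iota X.
Proof.
move=> /equalizer_diagonal_swap[T [iota [iota_inj R0P]]].
exists 'M[T]_(1 + 1), iota, [set swap T]; split=> //.
by apply/seteqP; split=> r /= => [/R0P ? _ -> //|/(_ _ erefl)/R0P].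
Qed.

Lemma equalizer_is_inner_invariants (R : pzRingType) (R0 : set R) :
  is_equalizer R0 ->
  exists (S : pzRingType) (iota : {rmorphism R -> S})
         (sigma : {rmorphism S -> S}),
    [/\ injective iota, inner_automorphism sigma, sigma \o sigma =1 id
      & R0 = invariants iota [set sigma]].
Proof.
move=> /equalizer_diagonal_swap[T [iota [iota_inj R0P]]].
(* [swap T] is its own inverse, so [swapK] supplies both inverse laws. *)
exists 'M[T]_(1 + 1), iota, (conj_by (swapK T) (swapK T)); split=> //.
- exact: inner_automorphism_conj_by.
- exact: conj_byK.
apply/seteqP; split=> r /= => [/R0P ? _ ->|/(_ _ erefl)].
  exact/conj_by_fixP.
by move=> /conj_by_fixP/R0P.
Qed.

Theorem proposition3p1 (R : pzRingType) (R0 : set R) (hR0 : is_subring R0) :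
  [<-> (* (a) *)
       exists (S : pzRingType) (iota : {rmorphism R -> S})
              (Sigma : set {rmorphism S -> S}),
         injective iota /\ R0 = invariants iota Sigma;
       (* (b) *)
       exists (S : pzRingType) (iota : {rmorphism R -> S}) (X : set S),
         injective iota /\ R0 = centralizer iota X;
       (* (c) *)
       exists (S : pzRingType) (iota : {rmorphism R -> S})
              (sigma : {rmorphism S -> S}),
         [/\ injective iota, automorphism sigma, sigma \o sigma =1 id
           & R0 = invariants iota [set sigma]];
       (* (d) *)
       exists (S : pzRingType) (iota : {rmorphism R -> S})
              (sigma : {rmorphism S -> S}),
         [/\ injective iota, inner_automorphism sigma, sigma \o sigma =1 id
           & R0 = invariants iota [set sigma]];
       (* (e) *)
       exists (I : Type) (S : I -> pzRingType)
              (psi1 psi2 : forall i : I, {rmorphism R -> S i}),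
         R0 = [set r | forall i : I, psi1 i r = psi2 i r]].
Proof.
(* The implications run in a cycle from (a) to (e) and back to (a). Condition (e) is
   [is_equalizer R0] unfolded, so the lemmas above apply directly. *)
tfae.
- move=> [S [iota [Sigma [_ ->]]]].
  exact/equalizer_is_centralizer/invariants_is_equalizer.
- move=> [S [iota [X [_ ->]]]].
  have [S' [iota' [sigma [? [? _] ? ?]]]] :=
    equalizer_is_inner_invariants (centralizer_is_equalizer iota X).
  by exists S', iota', sigma.
(* The given automorphism may fail to be inner, so only its invariant ring is kept, and a new
   overring with a new inner automorphism is built. *)
- move=> [S [iota [sigma [_ _ _ ->]]]].
  exact/equalizer_is_inner_invariants/invariants_is_equalizer.
- move=> [S [iota [sigma [_ _ _ ->]]]].
  exact: invariants_is_equalizer.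
- move=> /equalizer_is_inner_invariants[S [iota [sigma [? _ _ ?]]]].
  by exists S, iota, [set sigma].
Qed.
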